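(* Let $O=(0,0,0)$, $B=(0,0,1)$, and for $\theta>0$ let $\phi=\phi(\theta)=2\tan^{-1}(e^\theta)-\frac{\pi}{2}$. Consider on the unit sphere $x^2+y^2+z^2=1$ the points $P=(\cos\theta\sin\phi,\sin\theta\sin\phi,\cos\phi)$ and $Q=(\cos\theta,\sin\theta,0)$. Suppose the great circle tangent at $P$ to the curve traced by $P$ as $\theta$ varies intersects the great circle in the plane $xOy$ at the point $T$, where of the two antipodal intersection points $T$ is the one with $\widehat{TQ}<\frac{\pi}{2}$. Then: (1) the sum of the lengths of the arcs $PT$ and $TQ$ does not depend on $\theta$, and $\widehat{PT}+\widehat{TQ}=\frac{\pi}{2}$; (2) as $\theta$ increases, $\widehat{TQ}$ increases, $\widehat{PT}$ decreases, and both approach $\frac{\pi}{4}$ as $\theta\to\infty$; (3) the spherical angle $\angle QPT$ is equal to $\widehat{BP}$; (4) the spherical angle $\angle BPT$ is equal to $\widehat{PQ}+\frac{\pi}{2}$.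
   Context: For points $X,Y$ on the unit sphere with center $O$, $\widehat{XY}=\angle XOY$ denotes the spherical distance between $X$ and $Y$. The spherical angle $\angle XYZ$ is the angle at $Y$ between the great-circle arcs $YX$ and $YZ$ (the minor arcs). The curve traced by $P$ is the spherical interception curve. *)

(* Defs.v *)
From Stdlib Require Import Reals.
From Coquelicot Require Import Coquelicot.
Open Scope R_scope.

(** Points and vectors of Euclidean 3-space.  The left-nested product carries
    Coquelicot's product normed-module structure, so [plus], [minus], [scal]
    and [is_derive] act on it coordinatewise. *)
Definition point : Type := (R * R * R)%type.

Definition origin : point := (0, 0, 0).

Definition dot (u v : point) : R :=
  let '(u1, u2, u3) := u in
  let '(v1, v2, v3) := v in
  u1 * v1 + u2 * v2 + u3 * v3.

Definition vlength (u : point) : R := sqrt (dot u u).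

Definition vangle (u v : point) : R := acos (dot u v / (vlength u * vlength v)).

Definition on_sphere (X : point) : Prop :=
  let '(x, y, z) := X in x ^ 2 + y ^ 2 + z ^ 2 = 1.

(** The angle X O Y, which is also the length of the minor arc from X to Y. *)
Definition sdist (X Y : point) : R := vangle (minus X origin) (minus Y origin).

(** For Y on the sphere and X different from Y and its antipode, this is a
    positive multiple of the velocity at Y of the minor arc from Y to X: the
    component of X orthogonal to Y. *)
Definition arc_direction (Y X : point) : point := minus X (scal (dot X Y) Y).

(** The angle at the middle argument [Y]. *)
Definition sangle (X Y Z : point) : R :=
  vangle (arc_direction Y X) (arc_direction Y Z).

(** The great circle cut out by the plane through the origin with normal [n];
    meaningful for nonzero [n]. *)
Definition great_circle (n X : point) : Prop := on_sphere X /\ dot n X = 0.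

(** The great circle with normal [n] is tangent at time [t] to the spherical
    curve [c]: it passes through [c t], and its plane contains the nonzero
    velocity [v].  As [v] is orthogonal to [c t], the tangent line of the circle
    at [c t] is then the line directed by [v]. *)
Definition tangent_great_circle (c : R -> point) (t : R) (n : point) : Prop :=
  n <> origin /\ great_circle n (c t) /\
  exists v : point, is_derive c t v /\ v <> origin /\ dot n v = 0.

Definition phi (theta : R) : R := 2 * atan (exp theta) - PI / 2.

Definition ptB : point := (0, 0, 1).

Definition ptP (theta : R) : point :=
  (cos theta * sin (phi theta), sin theta * sin (phi theta), cos (phi theta)).

Definition ptQ (theta : R) : point := (cos theta, sin theta, 0).

(** [X] is a common point of the great circle tangent at [ptP theta] to the
    curve [ptP] and of the great circle in the plane z = 0. *)
Definition tangent_meets_equator (theta : R) (X : point) : Prop :=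
  exists n : point,
    tangent_great_circle ptP theta n /\ great_circle n X /\
    great_circle (0, 0, 1) X.

(* Main.v *)
Require Import Defs.
From Stdlib Require Import Reals Lra.
From Coquelicot Require Import Coquelicot.
Open Scope R_scope.

(** Why the theorem holds.  The function [phi] is the Gudermannian function,
    whose characteristic property is [phi' = cos phi].  Fix [theta], write
    [s = sin phi] and [c = cos phi], both positive, and use coordinates in the
    orthonormal frame [(Q, W, B)], where [W] is [Q] turned by a right angle in
    the equatorial plane.  There [P = (s, 0, c)], and because [phi' = c] the
    velocity is [V = (c^2, s, - s c)], a unit vector.

    The plane of the tangent great circle is spanned by [P] and [V], and the
    combination [s P + V = (1, s, 0)] is the one that lies in the equator
    (the first entry is [s^2 + c^2]).  Hence [T] is the normalization of
    [(1, s, 0)], with the sign fixed by the condition on [T] and [Q]: it lies on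
    the equator at angle [tau = atan s] from [Q] ([tangent_equator_point]).
    All the claims are read off from this position:
    - the cosine of the arc TQ is [cos tau] and that of PT is
      [s * cos tau = sin tau], so the arcs are [tau] and [PI / 2 - tau];
    - [s] increases to 1 as [theta] grows, so [tau] increases to [PI / 4];
    - with [E = (c, 0, - s)] the unit southward direction at [P], the arcs
      from [P] to [Q], [B] and [T] leave in the directions [E], [- E] and [V].
      As [dot E V = c], the two angles are [acos c] and [acos (- c)], that is
      [phi] and [PI - phi], while the arcs BP and PQ are [phi] and
      [PI / 2 - phi]. *)

(** * Angles between vectors *)

Lemma minus_point (x y z x' y' z' : R) :
  minus ((x, y, z) : point) (x', y', z') = (x - x', y - y', z - z').
Proof. reflexivity. Qed.

Lemma scal_point (a x y z : R) :
  scal a ((x, y, z) : point) = (a * x, a * y, a * z).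
Proof. reflexivity. Qed.

Lemma dot_scal_scal (a b : R) (u v : point) :
  dot (scal a u) (scal b v) = a * b * dot u v.
Proof.
destruct u as [[u1 u2] u3], v as [[v1 v2] v3]; rewrite !scal_point; cbn; ring.
Qed.

Lemma vangle_unit (u v : point) :
  dot u u = 1 -> dot v v = 1 -> vangle u v = acos (dot u v).
Proof.
intros Hu Hv; unfold vangle, vlength; rewrite Hu, Hv, sqrt_1; f_equal; field.
Qed.

Lemma vangle_scal_unit (a b : R) (u v : point) :
  0 < a -> 0 < b -> dot u u = 1 -> dot v v = 1 ->
  vangle (scal a u) (scal b v) = acos (dot u v).
Proof.
intros Ha Hb Hu Hv; unfold vangle, vlength.
rewrite !dot_scal_scal, Hu, Hv, !Rmult_1_r.
rewrite !sqrt_square by lra.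
f_equal; field; lra.
Qed.

Lemma minus_origin (X : point) : minus X origin = X.
Proof. destruct X as [[x y] z]; unfold origin; now rewrite minus_point, !Rminus_0_r. Qed.

Lemma sdist_unit (X Y : point) :
  dot X X = 1 -> dot Y Y = 1 -> sdist X Y = acos (dot X Y).
Proof.
intros HX HY; unfold sdist; rewrite !minus_origin; now apply vangle_unit.
Qed.

(** * The frame of the meridian through P *)

(** The vector with coordinates [x], [y], [z] in the orthonormal frame obtained
    from the standard one by the rotation of angle [t] about the z-axis. *)
Definition in_frame (t x y z : R) : point :=
  (x * cos t - y * sin t, x * sin t + y * cos t, z).

Lemma sin2_cos2_mul (t : R) : sin t * sin t + cos t * cos t = 1.
Proof. exact (sin2_cos2 t). Qed.

Lemma in_frame_exists (t : R) (X : point) :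
  exists x y z, X = in_frame t x y z.
Proof.
destruct X as [[x y] z].
exists (x * cos t + y * sin t), (y * cos t - x * sin t), z.
pose proof (sin2_cos2_mul t) as H; unfold in_frame; f_equal; f_equal.
- transitivity (x * (sin t * sin t + cos t * cos t)); [rewrite H|]; ring.
- transitivity (y * (sin t * sin t + cos t * cos t)); [rewrite H|]; ring.
Qed.

Lemma dot_in_frame (t x y z x' y' z' : R) :
  dot (in_frame t x y z) (in_frame t x' y' z') = x * x' + y * y' + z * z'.
Proof.
transitivity ((x * x' + y * y') * (sin t * sin t + cos t * cos t) + z * z').
- cbn; ring.
- rewrite sin2_cos2_mul; ring.
Qed.

Lemma scal_in_frame (t a x y z : R) :
  scal a (in_frame t x y z) = in_frame t (a * x) (a * y) (a * z).
Proof.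
unfold in_frame; rewrite scal_point; f_equal; f_equal; ring.
Qed.

Lemma arc_direction_in_frame (t x y z x' y' z' : R) :
  arc_direction (in_frame t x y z) (in_frame t x' y' z') =
  let d := x' * x + y' * y + z' * z in
  in_frame t (x' - d * x) (y' - d * y) (z' - d * z).
Proof.
unfold arc_direction; rewrite dot_in_frame, scal_in_frame.
unfold in_frame; rewrite minus_point; f_equal; f_equal; ring.
Qed.

Lemma on_sphere_dot (X : point) : on_sphere X -> dot X X = 1.
Proof. destruct X as [[x y] z]; cbn; lra. Qed.

Lemma ptB_in_frame (t : R) : ptB = in_frame t 0 0 1.
Proof. unfold ptB, in_frame; f_equal; f_equal; ring. Qed.

Lemma ptQ_in_frame (t : R) : ptQ t = in_frame t 1 0 0.
Proof. unfold ptQ, in_frame; f_equal; f_equal; ring. Qed.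

Lemma ptP_in_frame (t : R) :
  ptP t = in_frame t (sin (phi t)) 0 (cos (phi t)).
Proof. unfold ptP, in_frame; f_equal; f_equal; ring. Qed.

(** * The Gudermannian function *)

Lemma cos_phi (t : R) : cos (phi t) = 2 * exp t / (1 + (exp t)²).
Proof.
assert (Hp : 0 < 1 + (exp t)²) by (pose proof (Rle_0_sqr (exp t)); lra).
unfold phi; rewrite cos_minus, cos_PI2, sin_PI2, sin_2a, sin_atan, cos_atan.
rewrite <- (sqrt_sqrt (1 + (exp t)²)) at 3 by lra.
field; apply Rgt_not_eq, sqrt_lt_R0, Hp.
Qed.

(** The derivative and the cosine both equal [1 / cosh t]; this relation gives
    the curve unit speed. *)
Lemma is_derive_phi (t : R) : is_derive phi t (cos (phi t)).
Proof.
rewrite cos_phi; unfold phi.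
assert (Hp : 0 < 1 + (exp t)²) by (pose proof (Rle_0_sqr (exp t)); lra).
evar_last.
- apply (is_derive_minus (fun x => 2 * atan (exp x)) (fun _ => PI / 2)).
  + apply is_derive_scal.
    apply (is_derive_comp atan exp); [apply is_derive_atan | apply is_derive_exp].
  + apply is_derive_const.
- cbn; unfold minus, plus, opp, zero, scal, mult; cbn; unfold mult; cbn.
  field; lra.
Qed.

Lemma phi_increasing (t1 t2 : R) : t1 < t2 -> phi t1 < phi t2.
Proof.
intros H; unfold phi.
pose proof (atan_increasing _ _ (exp_increasing _ _ H)); lra.
Qed.

Lemma phi_bounds (t : R) : 0 < t -> 0 < phi t < PI / 2.
Proof.
intros H; split.
- pose proof (phi_increasing 0 t H) as H0; unfold phi in H0 at 1.
  rewrite exp_0, atan_1 in H0; lra.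
- unfold phi; pose proof (atan_bound (exp t)); lra.
Qed.

Lemma sin_phi_pos (t : R) : 0 < t -> 0 < sin (phi t).
Proof.
intros H; destruct (phi_bounds t H); pose proof PI_RGT_0.
apply sin_gt_0; lra.
Qed.

Lemma cos_phi_pos (t : R) : 0 < t -> 0 < cos (phi t).
Proof. intros H; destruct (phi_bounds t H); apply cos_gt_0; lra. Qed.

Lemma sin_phi_increasing (t1 t2 : R) :
  0 < t1 -> t1 < t2 -> sin (phi t1) < sin (phi t2).
Proof.
intros H1 H12; pose proof (phi_increasing t1 t2 H12).
destruct (phi_bounds t1 H1), (phi_bounds t2 (Rlt_trans _ _ _ H1 H12)).
apply sin_increasing_1; lra.
Qed.

Lemma phi_exp_opp (t : R) : phi t = PI / 2 - 2 * atan (exp (- t)).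
Proof. rewrite exp_Ropp, atan_inv by apply exp_pos; unfold phi; lra. Qed.

Lemma is_lim_exp_opp : is_lim (fun t => exp (- t)) p_infty 0.
Proof.
apply (is_lim_comp exp Ropp p_infty 0 m_infty).
- apply is_lim_exp_m.
- apply (is_lim_opp (fun x => x) p_infty p_infty), is_lim_id.
- exists 0; intros x _ H; discriminate.
Qed.

(** The reflection [phi_exp_opp] turns the limit at infinity into the
    continuity at 0 of a function of [exp (- t)]. *)
Lemma is_lim_atan_sin_phi :
  is_lim (fun t => atan (sin (phi t))) p_infty (PI / 4).
Proof.
set (g := fun y => atan (sin (PI / 2 - 2 * atan y))).
apply is_lim_ext with (fun t => g (exp (- t))).
- intros t; unfold g; now rewrite phi_exp_opp.
- replace (PI / 4) with (g 0).
  + apply is_lim_comp_continuous; [apply is_lim_exp_opp |].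
    apply continuity_pt_filterlim, derivable_continuous_pt; unfold g.
    apply (derivable_pt_comp (fun y => sin (PI / 2 - 2 * atan y)) atan).
    * reg; apply derivable_pt_atan.
    * apply derivable_pt_atan.
  + unfold g; rewrite atan_0.
    replace (PI / 2 - 2 * 0) with (PI / 2) by ring.
    now rewrite sin_PI2, atan_1.
Qed.

(** * The velocity of P *)

Lemma is_derive_fst {U V : NormedModule R_AbsRing} (f : R -> U * V) (t : R)
    (v : U * V) :
  is_derive (V := prod_NormedModule R_AbsRing U V) f t v ->
  is_derive (fun x => fst (f x)) t (fst v).
Proof.
intros H; unfold is_derive.
apply (filterdiff_comp' (V := prod_NormedModule R_AbsRing U V)
  f fst t _ fst H), filterdiff_linear, is_linear_fst.
Qed.

Lemma is_derive_snd {U V : NormedModule R_AbsRing} (f : R -> U * V) (t : R)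
    (v : U * V) :
  is_derive (V := prod_NormedModule R_AbsRing U V) f t v ->
  is_derive (fun x => snd (f x)) t (snd v).
Proof.
intros H; unfold is_derive.
apply (filterdiff_comp' (V := prod_NormedModule R_AbsRing U V)
  f snd t _ snd H), filterdiff_linear, is_linear_snd.
Qed.

Lemma is_derive_eq (f : R -> R) (t l l' : R) :
  is_derive f t l -> is_derive f t l' -> l = l'.
Proof.
intros H H'; now rewrite <- (is_derive_unique f t l H), (is_derive_unique f t l' H').
Qed.

Definition velocity (t : R) : point :=
  in_frame t (cos (phi t) ^ 2) (sin (phi t)) (- (sin (phi t) * cos (phi t))).

Lemma velocity_unique (t : R) (v : point) :
  is_derive ptP t v -> v = velocity t.
Proof.
destruct v as [[v1 v2] v3]; intros H.
pose proof (is_derive_fst _ _ _ (is_derive_fst _ _ _ H)) as H1.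
pose proof (is_derive_snd _ _ _ (is_derive_fst _ _ _ H)) as H2.
pose proof (is_derive_snd _ _ _ H) as H3.
cbn in H1, H2, H3.
pose proof (is_derive_phi t) as Hphi.
assert (Dphi : Derive (fun x => phi x) t = cos (phi t))
  by exact (is_derive_unique _ _ _ Hphi).
unfold velocity, in_frame; f_equal; [f_equal|].
- apply (is_derive_eq _ _ _ _ H1); auto_derive; [now exists (cos (phi t))|].
  rewrite Dphi; ring.
- apply (is_derive_eq _ _ _ _ H2); auto_derive; [now exists (cos (phi t))|].
  rewrite Dphi; ring.
- apply (is_derive_eq _ _ _ _ H3); auto_derive; [now exists (cos (phi t))|].
  rewrite Dphi; ring.
Qed.

Lemma velocity_unit (t : R) : dot (velocity t) (velocity t) = 1.
Proof.
unfold velocity; rewrite dot_in_frame.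
pose proof (sin2_cos2_mul (phi t)) as H.
set (s := sin (phi t)) in *; set (c := cos (phi t)) in *.
transitivity (c * c * (s * s + c * c) + s * s); [ring | rewrite H; lra].
Qed.

(** * The point T *)

Lemma sin_atan_mult_cos (s : R) : sin (atan s) = s * cos (atan s).
Proof. rewrite sin_atan, cos_atan; unfold Rdiv; ring. Qed.

(** On the half circle [x > 0] the slope [s] determines the point, and
    [atan s] is its polar angle. *)
Lemma unit_vector_of_slope (s x : R) :
  0 < x -> x * x + (s * x) * (s * x) = 1 -> x = cos (atan s) /\ s * x = sin (atan s).
Proof.
intros Hx H.
assert (Hc : 0 < cos (atan s)) by (pose proof (atan_bound s); apply cos_gt_0; lra).
pose proof (sin_atan_mult_cos s) as Hs.
assert (Hxc : x = cos (atan s)).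
{ apply Rsqr_inj; [lra | lra |].
  pose proof (sin2_cos2 (atan s)) as H1; rewrite Hs in H1; unfold Rsqr in *.
  apply Rmult_eq_reg_l with (1 + s * s); nra. }
split; [exact Hxc | now rewrite Hs, Hxc].
Qed.

(** The normalization of the vector with frame coordinates
    [(1, sin (phi t), 0)]. *)
Definition ptT (t : R) : point :=
  let tau := atan (sin (phi t)) in in_frame t (cos tau) (sin tau) 0.

(** A normal [n] of the tangent plane with frame coordinates [(a, b, d)]
    satisfies [dot n (s P + V) = a + s b = 0].  With [dot n P = 0] this
    shows that [n] vanishes if [b] does.  So [b] is nonzero, and [dot n T = 0]
    forces [T] to be proportional to [(1, s, 0)]; the arc TQ being less than a
    right angle makes the factor positive. *)
Lemma tangent_equator_point (t : R) (X : point) :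
  0 < t -> tangent_meets_equator t X -> sdist X (ptQ t) < PI / 2 ->
  X = ptT t.
Proof.
intros Ht [n [[Hn0 [[_ HnP] [v [Hv [_ Hnv]]]]] [[HXs HnX] [_ HXB]]]] HXQ.
apply on_sphere_dot in HXs.
apply velocity_unique in Hv; subst v; unfold velocity in Hnv.
destruct (in_frame_exists t n) as [a [b [d En]]].
destruct (in_frame_exists t X) as [x [y [z EX]]].
rewrite sdist_unit in HXQ; [|exact HXs|].
2: { rewrite ptQ_in_frame, dot_in_frame; ring. }
assert (HB : dot ptB X = 0) by exact HXB.
rewrite (ptB_in_frame t) in HB.
rewrite ptP_in_frame in HnP; rewrite ptQ_in_frame in HXQ.
subst n X; rewrite dot_in_frame in *.
pose proof (sin2_cos2_mul (phi t)) as Hsc.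
pose proof (cos_phi_pos t Ht) as Hc.
unfold ptT; set (s := sin (phi t)) in *; set (c := cos (phi t)) in *.
assert (Hz : z = 0) by lra; subst z.
assert (Hx : 0 < x).
{ replace (x * 1 + y * 0 + 0 * 0) with x in HXQ by ring.
  pose proof (acos_bound x).
  rewrite <- (cos_acos x) by nra.
  apply cos_gt_0; lra. }
(* The combination of the equations for [P], with factor [s], and for the
   velocity, in which [d] cancels. *)
assert (Hab : a + s * b = 0).
{ transitivity (a * (s * s + c * c) + s * b); [rewrite Hsc; ring|].
  transitivity (s * (a * s + b * 0 + d * c) + (a * c ^ 2 + b * s + d * - (s * c)));
    [ring | rewrite HnP, Hnv; ring]. }
assert (Hb : b <> 0).
{ intros Hb; subst b; apply Hn0.
  assert (Ha : a = 0) by lra; subst a.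
  assert (Hd : d = 0) by (apply Rmult_eq_reg_r with c; lra); subst d.
  unfold in_frame, origin; f_equal; f_equal; ring. }
assert (Hy : y = s * x).
{ apply Rmult_eq_reg_l with b; [|exact Hb].
  replace a with (- (s * b)) in HnX by lra; lra. }
subst y.
destruct (unit_vector_of_slope s x Hx) as [E1 E2]; [lra|].
now rewrite <- E1, <- E2.
Qed.

(** * Arcs and angles *)

Lemma atan_sin_phi_bounds (t : R) : 0 < t -> 0 < atan (sin (phi t)) < PI / 2.
Proof.
intros Ht; pose proof (atan_increasing _ _ (sin_phi_pos t Ht)) as H.
rewrite atan_0 in H; pose proof (atan_bound (sin (phi t))); lra.
Qed.

Lemma acos_sin (x : R) : - (PI / 2) <= x <= PI / 2 -> acos (sin x) = PI / 2 - x.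
Proof. intros H; rewrite <- cos_shift; apply acos_cos; lra. Qed.

Lemma ptB_unit : dot ptB ptB = 1.
Proof. cbn; ring. Qed.

Lemma ptQ_unit (t : R) : dot (ptQ t) (ptQ t) = 1.
Proof. rewrite ptQ_in_frame, dot_in_frame; ring. Qed.

Lemma ptP_unit (t : R) : dot (ptP t) (ptP t) = 1.
Proof.
rewrite ptP_in_frame, dot_in_frame; pose proof (sin2_cos2_mul (phi t)); lra.
Qed.

Lemma ptT_unit (t : R) : dot (ptT t) (ptT t) = 1.
Proof.
unfold ptT; rewrite dot_in_frame.
pose proof (sin2_cos2_mul (atan (sin (phi t)))); lra.
Qed.

Lemma sdist_T_Q (t : R) : 0 < t -> sdist (ptT t) (ptQ t) = atan (sin (phi t)).
Proof.
intros Ht; rewrite sdist_unit by (apply ptT_unit || apply ptQ_unit).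
unfold ptT; rewrite ptQ_in_frame, dot_in_frame.
rewrite <- (acos_cos (atan (sin (phi t)))) at 3.
- f_equal; ring.
- pose proof (atan_sin_phi_bounds t Ht); lra.
Qed.

(** The cosine of this arc is [s * cos tau], which is [sin tau] since
    [s = tan tau]: hence the complement of the arc TQ. *)
Lemma sdist_P_T (t : R) :
  0 < t -> sdist (ptP t) (ptT t) = PI / 2 - atan (sin (phi t)).
Proof.
intros Ht; rewrite sdist_unit by (apply ptP_unit || apply ptT_unit).
unfold ptT; rewrite ptP_in_frame, dot_in_frame.
rewrite <- acos_sin.
- f_equal; rewrite sin_atan_mult_cos; ring.
- pose proof (atan_sin_phi_bounds t Ht); lra.
Qed.

Lemma sdist_B_P (t : R) : 0 < t -> sdist ptB (ptP t) = phi t.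
Proof.
intros Ht; rewrite sdist_unit by (apply ptB_unit || apply ptP_unit).
rewrite (ptB_in_frame t), ptP_in_frame, dot_in_frame.
rewrite <- (acos_cos (phi t)) at 3.
- f_equal; ring.
- pose proof (phi_bounds t Ht); lra.
Qed.

Lemma sdist_P_Q (t : R) : 0 < t -> sdist (ptP t) (ptQ t) = PI / 2 - phi t.
Proof.
intros Ht; rewrite sdist_unit by (apply ptP_unit || apply ptQ_unit).
rewrite ptP_in_frame, ptQ_in_frame, dot_in_frame, <- acos_sin.
- f_equal; ring.
- pose proof (phi_bounds t Ht); lra.
Qed.

(** The unit vector tangent at [P] to the meridian, pointing to the equator. *)
Definition south (t : R) : point :=
  in_frame t (cos (phi t)) 0 (- sin (phi t)).

Lemma south_unit (t : R) : dot (south t) (south t) = 1.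
Proof.
unfold south; rewrite dot_in_frame; pose proof (sin2_cos2_mul (phi t)); lra.
Qed.

Lemma dot_south_velocity (t : R) : dot (south t) (velocity t) = cos (phi t).
Proof.
unfold south, velocity; rewrite dot_in_frame.
pose proof (sin2_cos2_mul (phi t)) as H.
set (s := sin (phi t)) in *; set (c := cos (phi t)) in *.
transitivity (c * (s * s + c * c)); [ring | rewrite H; ring].
Qed.

(** Each direction at [P] is factored as a positive scalar times a unit vector,
    because positive scalars leave [vangle] unchanged. *)
Lemma arc_direction_P_Q (t : R) :
  arc_direction (ptP t) (ptQ t) = scal (cos (phi t)) (south t).
Proof.
rewrite ptP_in_frame, ptQ_in_frame, arc_direction_in_frame; unfold south.
rewrite scal_in_frame; cbv zeta.
pose proof (sin2_cos2_mul (phi t)); f_equal; lra.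
Qed.

Lemma arc_direction_P_B (t : R) :
  arc_direction (ptP t) ptB = scal (sin (phi t)) (scal (- 1) (south t)).
Proof.
rewrite ptP_in_frame, (ptB_in_frame t), arc_direction_in_frame; unfold south.
rewrite !scal_in_frame; cbv zeta.
pose proof (sin2_cos2_mul (phi t)); f_equal; lra.
Qed.

Lemma arc_direction_P_T (t : R) :
  arc_direction (ptP t) (ptT t) =
  scal (cos (atan (sin (phi t)))) (velocity t).
Proof.
unfold ptT; rewrite ptP_in_frame, arc_direction_in_frame; unfold velocity.
rewrite scal_in_frame, sin_atan_mult_cos; cbv zeta.
pose proof (sin2_cos2_mul (phi t)) as H.
set (k := cos (atan _)).
set (s := sin (phi t)) in *; set (c := cos (phi t)) in *.
f_equal; try ring.
transitivity (k * (1 - s * s)); [ring | rewrite <- H; ring].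
Qed.

Lemma sangle_Q_P_T (t : R) : 0 < t -> sangle (ptQ t) (ptP t) (ptT t) = phi t.
Proof.
intros Ht; destruct (atan_sin_phi_bounds t Ht), (phi_bounds t Ht).
unfold sangle; rewrite arc_direction_P_Q, arc_direction_P_T.
rewrite vangle_scal_unit, dot_south_velocity.
- apply acos_cos; lra.
- now apply cos_phi_pos.
- apply cos_gt_0; lra.
- apply south_unit.
- apply velocity_unit.
Qed.

Lemma sangle_B_P_T (t : R) : 0 < t -> sangle ptB (ptP t) (ptT t) = PI - phi t.
Proof.
intros Ht; destruct (atan_sin_phi_bounds t Ht), (phi_bounds t Ht).
unfold sangle; rewrite arc_direction_P_B, arc_direction_P_T.
rewrite vangle_scal_unit.
(* The factor 1 puts the product in the form of [dot_scal_scal]. *)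
- replace (velocity t) with (scal 1 (velocity t))
    by (unfold velocity; rewrite scal_in_frame; f_equal; ring).
  rewrite dot_scal_scal, dot_south_velocity.
  replace (- 1 * 1 * cos (phi t)) with (cos (PI - phi t))
    by (rewrite Rtrigo_facts.cos_pi_minus; ring).
  apply acos_cos; lra.
- now apply sin_phi_pos.
- apply cos_gt_0; lra.
- rewrite dot_scal_scal, south_unit; ring.
- apply velocity_unit.
Qed.

Theorem theorem5 (T : R -> point)
  (hT : forall theta : R, 0 < theta ->
    tangent_meets_equator theta (T theta) /\
    sdist (T theta) (ptQ theta) < PI / 2) :
  (* (1) *)
  ((forall theta1 theta2 : R, 0 < theta1 -> 0 < theta2 ->
      sdist (ptP theta1) (T theta1) + sdist (T theta1) (ptQ theta1) =
      sdist (ptP theta2) (T theta2) + sdist (T theta2) (ptQ theta2)) /\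
   (forall theta : R, 0 < theta ->
      sdist (ptP theta) (T theta) + sdist (T theta) (ptQ theta) = PI / 2)) /\
  (* (2) *)
  ((forall theta1 theta2 : R, 0 < theta1 -> theta1 < theta2 ->
      sdist (T theta1) (ptQ theta1) < sdist (T theta2) (ptQ theta2)) /\
   (forall theta1 theta2 : R, 0 < theta1 -> theta1 < theta2 ->
      sdist (ptP theta2) (T theta2) < sdist (ptP theta1) (T theta1)) /\
   is_lim (fun theta : R => sdist (T theta) (ptQ theta)) p_infty (PI / 4) /\
   is_lim (fun theta : R => sdist (ptP theta) (T theta)) p_infty (PI / 4)) /\
  (* (3) *)
  (forall theta : R, 0 < theta ->
     sangle (ptQ theta) (ptP theta) (T theta) = sdist ptB (ptP theta)) /\
  (* (4) *)
  (forall theta : R, 0 < theta ->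
     sangle ptB (ptP theta) (T theta) =
     sdist (ptP theta) (ptQ theta) + PI / 2).
Proof.
assert (ET : forall t, 0 < t -> T t = ptT t).
{ intros t Ht; destruct (hT t Ht); now apply tangent_equator_point. }
assert (ETQ : forall t, 0 < t -> sdist (T t) (ptQ t) = atan (sin (phi t))).
{ intros t Ht; rewrite ET by exact Ht; now apply sdist_T_Q. }
assert (EPT : forall t, 0 < t ->
  sdist (ptP t) (T t) = PI / 2 - atan (sin (phi t))).
{ intros t Ht; rewrite ET by exact Ht; now apply sdist_P_T. }
assert (Hmono : forall t1 t2, 0 < t1 -> t1 < t2 ->
  atan (sin (phi t1)) < atan (sin (phi t2))).
{ intros t1 t2 H1 H12; now apply atan_increasing, sin_phi_increasing. }
repeat split.
- intros t1 t2 H1 H2; rewrite !ETQ, !EPT by assumption; lra.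
- intros t Ht; rewrite ETQ, EPT by exact Ht; lra.
- intros t1 t2 H1 H12; rewrite !ETQ by lra; now apply Hmono.
- intros t1 t2 H1 H12; rewrite !EPT by lra.
  pose proof (Hmono t1 t2 H1 H12); lra.
- apply is_lim_ext_loc with (fun t => atan (sin (phi t))).
  + exists 0; intros t Ht; symmetry; now apply ETQ.
  + apply is_lim_atan_sin_phi.
- apply is_lim_ext_loc with (fun t => PI / 2 - atan (sin (phi t))).
  + exists 0; intros t Ht; symmetry; now apply EPT.
  + replace (PI / 4) with (PI / 2 - PI / 4) by field.
    apply is_lim_minus'; [apply is_lim_const | apply is_lim_atan_sin_phi].
- intros t Ht; rewrite ET, sangle_Q_P_T, sdist_B_P by exact Ht; reflexivity.
- intros t Ht; rewrite ET, sangle_B_P_T, sdist_P_Q by exact Ht; lra.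
Qed.
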